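(* In the comparison query model, no deterministic algorithm can be better than $2$-competitive for the problem of verifying that a given matching $M$ in a stable matching instance with uncertain preferences on both sides is stable.
   Context: Two disjoint sets $A$, $B$ of agents with $|A|=|B|=n$. Each $a\in A$ has a strict total order $\prec_a$ on $B$ and each $b\in B$ has a strict total order $\prec_b$ on $A$ ($x\prec_y z$: $y$ prefers $x$ to $z$). A matching is a bijection between $A$ and $B$; it is stable if there is no pair $(a,b)$, $b\neq M(a)$, with $a$ preferring $b$ to $M(a)$ and $b$ preferring $a$ to $M(b)$. Two-sided uncertainty: all preference orders of agents in $A$ and in $B$ are initially unknown and are learned only via comparison queries: for an agent $x$ and two agents $y_1,y_2$ of the other side, $\mathit{prefer}(x,y_1,y_2)$ returns whichever of $y_1,y_2$ agent $x$ prefers. An algorithm queries adaptively until the answers prove its output correct. It is $\rho$-competitive if its number of queries is at most $\rho$ times the minimum size of a query set whose answers suffice to prove that $M$ is stable; the competitive ratio is measured only on inputs where $M$ is stable. *)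

(* Defs.v *)
From mathcomp Require Import all_boot all_order all_algebra.

Set Implicit Arguments.
Unset Strict Implicit.
Unset Printing Implicit Defensive.

Import Order.TTheory GRing.Theory Num.Theory.
Local Open Scope ring_scope.

(* [prec r x z] means that x is strictly preferred to z. *)
Record strict_order (T : finType) := StrictOrder {
  prec :> rel T;
  prec_irr : irreflexive prec;
  prec_trans : transitive prec;
  prec_total : forall x y, x != y -> prec x y || prec y x }.

(* The two sides are given by two types, so they are disjoint by typing. *)
Record profile (A B : finType) := Profile {
  prefA : A -> strict_order B;
  prefB : B -> strict_order A }.

(* A bijection given together with its inverse, so that both M(a) and M(b) are
   available; its existence forces #|A| = #|B|. *)
Record matching (A B : finType) := Matching {
  mateA : A -> B;
  mateB : B -> A;
  mateAK : cancel mateA mateB;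
  mateBK : cancel mateB mateA }.

Definition blocking (A B : finType) (P : profile A B) (M : matching A B)
    (a : A) (b : B) : bool :=
  [&& b != mateA M a, prefA P a b (mateA M a) & prefB P b a (mateB M b)].

Definition stable (A B : finType) (P : profile A B) (M : matching A B) : bool :=
  ~~ [exists a, exists b, blocking P M a b].

(* [inl (a, b1, b2)] asks agent a of A to compare b1 and b2;
   [inr (b, a1, a2)] asks agent b of B to compare a1 and a2. *)
Definition query (A B : finType) : finType := (A * B * B + B * A * A)%type.

(* The answer is whichever of the two compared agents is preferred. *)
Definition prefer (A B : finType) (P : profile A B) (q : query A B) : A + B :=
  match q with
  | inl (a, b1, b2) => inr (if prefA P a b1 b2 then b1 else b2)
  | inr (b, a1, a2) => inl (if prefB P b a1 a2 then a1 else a2)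
  end.

(* The answers that P gives to the queries in Q prove that the truth value of
   "M is stable" is v. *)
Definition proves (A B : finType) (P : profile A B) (M : matching A B)
    (Q : {set query A B}) (v : bool) : Prop :=
  forall P' : profile A B,
    {in Q, forall q, prefer P' q = prefer P q} -> stable P' M = v.

Definition min_proof_size (A B : finType) (P : profile A B) (M : matching A B)
    (m : nat) : Prop :=
  (exists2 Q : {set query A B}, proves P M Q true & #|Q| = m) /\
  (forall Q : {set query A B}, proves P M Q true -> (m <= #|Q|)%N).

(* Decision trees: the next query depends only on the answers received so far.
   The output states whether M is stable. *)
Inductive strategy (A B : finType) :=
  | Output of bool
  | Ask of query A B & (A + B -> strategy A B).

(* The sequence of queries made on input P, with repetitions. *)
Fixpoint asked (A B : finType) (P : profile A B) (S : strategy A B) :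
    seq (query A B) :=
  match S with
  | Output _ => [::]
  | Ask q k => q :: asked P (k (prefer P q))
  end.

Fixpoint output (A B : finType) (P : profile A B) (S : strategy A B) : bool :=
  match S with
  | Output v => v
  | Ask q k => output P (k (prefer P q))
  end.

(* The agents and the matching are known in advance; the preferences are
   accessed only through queries. *)
Definition algorithm := forall A B : finType, matching A B -> strategy A B.

Definition verifies_stability (alg : algorithm) : Prop :=
  forall (A B : finType) (M : matching A B) (P : profile A B),
    proves P M [set q in asked P (alg A B M)] (output P (alg A B M)).

Definition competitive (R : realFieldType) (rho : R) (alg : algorithm) : Prop :=
  forall (A B : finType) (M : matching A B) (P : profile A B) (m : nat),
    stable P M -> min_proof_size P M m ->
    (size (asked P (alg A B M)))%:R <= rho * m%:R.

(* Main.v *)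
Require Import Defs.
From mathcomp Require Import all_boot all_order all_algebra.

(** Take n = 2 and number the agents so that p in A and p in B are never
    matched to each other: the only candidates for blocking are the two pairs
    (p, p), and every agent has a single unknown bit, namely whether it prefers
    its mate to the other member of its pair.  The adversary lets the first
    member of each pair that is asked prefer its partner in the pair, and the
    second one prefer its mate.  A proof of stability must contain the query to
    the content member of each pair, and these two queries suffice, so the
    optimum is 2; but the algorithm reaches the content members only after
    having asked the other two agents, that is, after 4 queries. *)

Import Order.TTheory GRing.Theory Num.Theory.
Local Open Scope ring_scope.

Definition top_rel (c : bool) : rel bool := fun x z => (x == c) && (z != c).

Lemma top_rel_irr c : irreflexive (top_rel c).
Proof. by case: c => -[]. Qed.

Lemma top_rel_trans c : transitive (top_rel c).
Proof. by case: c => -[] [] []. Qed.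

Lemma top_rel_total c x y : x != y -> top_rel c x y || top_rel c y x.
Proof. by case: c x y => -[] []. Qed.

Definition top_order (c : bool) : strict_order bool :=
  StrictOrder (top_rel_irr c) (top_rel_trans c) (@top_rel_total c).

Definition cross_matching : matching bool bool := Matching negbK negbK.

(* [(p, true)] is the agent p of A, [(p, false)] the agent p of B;
   [g (p, c)] says that this agent prefers its mate [~~ p] to [p]. *)
Definition bit_profile (g : bool * bool -> bool) : profile bool bool :=
  Profile (fun p => top_order (p (+) g (p, true)))
          (fun p => top_order (p (+) g (p, false))).

(* [None] for the uninformative queries that compare an agent with itself. *)
Definition queried_agent (q : query bool bool) : option (bool * bool) :=
  match q with
  | inl (p, x, y) => if x == y then None else Some (p, true)
  | inr (p, x, y) => if x == y then None else Some (p, false)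
  end.

Lemma prefer_bit_profile g g' q :
  (forall x, queried_agent q = Some x -> g x = g' x) ->
  prefer (bit_profile g) q = prefer (bit_profile g') q.
Proof.
case: q => [[[p x] y]|[[p x] y]] /=; rewrite /top_rel.
  by case: eqP => [-> _|_ /(_ _ erefl) ->] //; rewrite !if_same.
by case: eqP => [-> _|_ /(_ _ erefl) ->] //; rewrite !if_same.
Qed.

Lemma stable_bit_profile g :
  stable (bit_profile g) cross_matching =
  [forall p, g (p, true) || g (p, false)].
Proof.
apply/idP/forallP => [st p|gP].
  apply: contraR st; rewrite negb_or => /andP[/negbTE gt /negbTE gf].
  apply/existsP; exists p; apply/existsP; exists p.
  by rewrite /blocking /= /top_rel gt gf; case: p {gt gf}.
apply/negP => /existsP[a /existsP[b]]; rewrite /blocking /= /top_rel.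
have := gP a; have := gP b.
by case: a b => -[]; case: (g (_, true)); case: (g (_, false)).
Qed.

(* In the pair p, the agent on the side [o p] prefers its partner in the pair,
   and the other one prefers its mate. *)
Definition oriented (o : bool -> bool) : bool * bool -> bool :=
  fun x => x.2 != o x.1.

Lemma stable_oriented o : stable (bit_profile (oriented o)) cross_matching.
Proof.
rewrite stable_bit_profile; apply/forallP => p; rewrite /oriented /=.
by case: (o p).
Qed.

(** Flipping the bit of the content agent makes [(p, p)] blocking, and only queries to that agent
    can detect the flip. *)
Lemma proof_asks_content o Q v p :
  proves (bit_profile (oriented o)) cross_matching Q v ->
  exists2 q, q \in Q & queried_agent q = Some (p, ~~ o p).
Proof.
move=> prf; have vT : v = true.
  by rewrite -(prf _ (fun _ _ => erefl)) stable_oriented.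
case: (boolP [exists q in Q, queried_agent q == Some (p, ~~ o p)]).
  by case/exists_inP=> q qQ /eqP; exists q.
move/exists_inPn => noq.
pose g x := oriented o x && (x != (p, ~~ o p)).
have: stable (bit_profile g) cross_matching = v.
  apply: prf => q qQ; apply: prefer_bit_profile => x qx.
  have := noq q qQ; rewrite qx /g => nx.
  by rewrite (_ : x != _) ?andbT //; apply: contra nx => /eqP ->.
rewrite vT stable_bit_profile => /forallP/(_ p).
by rewrite /g /oriented /= !xpair_eqE !eqxx; case: (o p).
Qed.

Lemma min_proof_size_oriented o :
  min_proof_size (bit_profile (oriented o)) cross_matching 2.
Proof.
(* The content agent compares its mate with its partner, which rules out [(p, p)]. *)
pose qc p : query bool bool :=
  if o p then inr (p, ~~ p, p) else inl (p, ~~ p, p).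
split=> [|Q prf].
  exists [set qc p | p : bool]; last first.
    rewrite card_imset ?card_bool // => p p'; rewrite /qc.
    by case: (o p); case: (o p') => // -[].
  move=> P' agree; apply/negP => /existsP[a /existsP[b]].
  rewrite /blocking /= => /and3P[ba].
  have {ba} -> : b = a by case: a b ba => -[].
  move=> Pa Pb; have/agree: qc a \in [set qc p | p : bool] by apply: imset_f.
  have asym (S : strict_order bool) x y : S x y -> S y x = false.
    by move=> Sxy; apply/negP => /(prec_trans Sxy); rewrite prec_irr.
  rewrite /qc; case oa: (o a) => /=;
    rewrite (asym _ _ _ Pa, asym _ _ _ Pb) /top_rel /oriented /= oa;
    by case: a {Pa Pb oa}.
have [q0 q0Q a0] := proof_asks_content o Q true false prf.
have [q1 q1Q a1] := proof_asks_content o Q true true prf.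
have neq : q0 != q1 by apply: contra_eq_neq a0 => ->; rewrite a1.
have <- : #|[set q0; q1]| = 2%N by rewrite cards2 neq.
by apply/subset_leq_card/subsetP => q; rewrite !inE => /orP[] /eqP ->.
Qed.

(* The state [s] records the pairs already oriented by the adversary. *)
Lemma adversary (S : strategy bool bool) (s : bool -> option bool) :
  exists2 o : bool -> bool,
    (forall p c, s p = Some c -> o p = c) &
    let agents := pmap queried_agent (asked (bit_profile (oriented o)) S) in
    forall p, s p = None -> (p, ~~ o p) \in agents -> (p, o p) \in agents.
Proof.
elim: S s => [v|q k IH] s.
  by exists (fun p => odflt true (s p)) => // p c ->.
case qx: (queried_agent q) => [[p0 c0]|]; last first.
  (* [negb] is arbitrary: this answer does not depend on the orientation. *)
  pose ans := prefer (bit_profile (oriented negb)) q.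
  have [o os oP] := IH ans s; exists o => //=.
  rewrite (prefer_bit_profile (oriented o) (oriented negb)) ?qx //.
(* The first agent asked orients its pair; an earlier choice is kept. *)
pose s' p := if p == p0 then Some (odflt c0 (s p)) else s p.
pose ans := prefer (bit_profile (oriented (fun p => odflt c0 (s' p)))) q.
have [o os' oP] := IH ans s'.
have op0 : o p0 = odflt c0 (s p0) by apply: os'; rewrite /s' eqxx.
have ansE : prefer (bit_profile (oriented o)) q = ans.
  apply: prefer_bit_profile => x; rewrite qx => -[<-].
  by rewrite /oriented /= /s' eqxx op0.
exists o => [p c sp|/= p sp].
  by apply: os'; rewrite /s' sp; case: eqP.
rewrite ansE qx /= !inE.
have [pE _|np] := eqVneq p p0; first by rewrite pE op0 -pE sp eqxx.
rewrite !xpair_eqE (negbTE np) /=; apply: oP.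
by rewrite /s' (negbTE np).
Qed.

Theorem theorem14 (R : realFieldType) (alg : algorithm) (rho : R)
    (halg : verifies_stability alg) (hrho : rho < 2) :
  ~ competitive rho alg.
Proof.
pose S := alg bool bool cross_matching.
have [o _ /= bad] := adversary S (fun=> None).
set P := bit_profile (oriented o) in bad.
have content p : (p, ~~ o p) \in pmap queried_agent (asked P S).
  have [q] := proof_asks_content _ _ _ p (halg _ _ cross_matching P).
  by rewrite inE mem_pmap => qS <-; apply: map_f.
(* All four agents are asked, and each query concerns at most one. *)
have four : (4 <= size (asked P S))%N.
  have -> : 4%N = #|{: bool * bool}| by rewrite card_prod card_bool.
  have le : (size (pmap queried_agent (asked P S)) <= size (asked P S))%N.
    by rewrite size_pmap count_size.
  apply: leq_trans le.
  rewrite cardE; apply: uniq_leq_size (enum_uniq _) _ => -[p c] _.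
  have := content p; have := bad p erefl (content p).
  by case: (o p); case: c.
move=> /(_ _ _ _ _ _ (stable_oriented o) (min_proof_size_oriented o)).
apply/negP; rewrite -ltNge.
apply: lt_le_trans (_ : 4%:R <= _); last by rewrite ler_nat.
by rewrite (natrM R 2 2) ltr_pM2r ?ltr0n.
Qed.
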